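(* Let $N\ge1$, let $A\in\mathbb{R}^{n\times n}$ and $B\in\mathbb{R}^{n\times p}$ be such that $(A,B)$ is controllable, and let $Q\in\mathbb{R}^{n\times n}$, $R\in\mathbb{R}^{Np\times Np}$ with $Q>0$, $R>0$. Consider the optimal centroid stabilization problem $$\underset{u(\cdot)}{\text{minimize}}\ \int_0^\infty\left(y^\top Qy+u^\top Ru\right)dt\quad\text{subject to}\quad \dot{x}=(I_N\otimes A)x+(I_N\otimes B)u,\quad y=\begin{pmatrix}I_n&\cdots&I_n\end{pmatrix}x=\sum_{i=1}^N x_i .$$ Then: (i) The optimal feedback is of the form $u=Ky$ for some constant matrix $K\in\mathbb{R}^{Np\times n}$. (ii) If moreover $R=I_N\otimes W$ with $W\in\mathbb{R}^{p\times p}$, $W>0$, then the optimal feedback is the broadcast feedback $$u^\star=-(\mathbf{1}_N\otimes W^{-1}B^\top P)\,y,$$ i.e. $u_i^\star=-W^{-1}B^\top P\,y$ for every $i=1,\dots,N$, where $P$ is the unique positive definite solution of the algebraic Riccati equation $$PA+A^\top P-N\,PBW^{-1}B^\top P+Q=0.$$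
   Context: $N$ homogeneous linear systems $\dot{x}_i=Ax_i+Bu_i$, $i=1,\dots,N$, with $x_i\in\mathbb{R}^n$, $u_i\in\mathbb{R}^p$, are stacked as $x=(x_1,\dots,x_N)\in\mathbb{R}^{Nn}$, $u=(u_1,\dots,u_N)\in\mathbb{R}^{Np}$. $\mathbf{1}_N\in\mathbb{R}^N$ is the all-ones vector, $I_k$ is the $k\times k$ identity matrix, $\otimes$ is the Kronecker product. $M>0$ means $M$ is symmetric positive definite. The output $y$ equals $N\bar{x}$, where $\bar{x}=\frac1N\sum_{i=1}^N x_i$ is the centroid, and along solutions satisfies $\dot{y}=Ay+\begin{pmatrix}B&\cdots&B\end{pmatrix}u$; the problem can equivalently be posed with these dynamics. A broadcast feedback is one in which every system receives the same input signal, computed from the aggregated quantity $y$. Convention for the optimal control problem: the initial state $x(0)$ is an arbitrary given vector; the minimization is over all input functions $u:[0,\infty)\to\mathbb{R}^{Np}$ (say, locally square integrable, so that the state trajectory is well defined), with no requirement that the resulting state trajectory converge to the origin. ''The optimal feedback is $u=Ky$'' means that there is one constant matrix $K$, not depending on $x(0)$, such that for every initial state the input generated by this feedback attains the minimum of the cost. *)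

(* Defs.v *)
From mathcomp Require Import all_boot all_order all_algebra.
From mathcomp Require character.
From mathcomp Require Import all_classical all_reals all_analysis.

Set Implicit Arguments.
Unset Strict Implicit.
Unset Printing Implicit Defensive.

Import Order.TTheory GRing.Theory Num.Theory.
Import numFieldNormedType.Exports.

Local Open Scope classical_set_scope.
Local Open Scope ring_scope.

(* The Kronecker product; its entries are given by [kronE] below. *)
Notation kron := character.tprod.

Section KroneckerEntries.

Lemma index_allpairs_pair (S T : eqType) (s : seq S) (t : seq T) x y :
  x \in s -> y \in t ->
  index (x, y) [seq (a, b) | a <- s, b <- t]
  = (index x s * size t + index y t)%N.
Proof.
move=> xs yt; elim: s xs => //= a s IHs; rewrite inE index_cat size_map.
have [<- _|ax] := eqVneq a x.
  have inj : injective (pair a : T -> S * T) by move=> ? ? [].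
  by rewrite (mem_map inj) yt (index_map inj).
move=> /= xs.
rewrite ifN; first by rewrite IHs // mulSn addnA.
by apply/mapP => -[z _ [xa _]]; rewrite xa eqxx in ax.
Qed.

Lemma val_mxvec_index m n (i : 'I_m) (j : 'I_n) :
  mxvec_index i j = (i * n + j)%N :> nat.
Proof.
have -> : mxvec_index i j = index (i, j) (enum {: 'I_m * 'I_n}) :> nat.
  rewrite /= -[in RHS](nth_enum_rank (i, j) (i, j)).
  by rewrite index_uniq ?enum_uniq// -cardE.
rewrite enumT unlock /= /prod_enum index_allpairs_pair ?mem_enum//.
by rewrite !index_enum_ord size_enum_ord.
Qed.

Variable F : fieldType.

Lemma trow_val n1 (A : 'rV[F]_n1) m2 n2 (B : 'M[F]_(m2, n2))
    (j : 'I_n1) (k : 'I_m2) (l : 'I_n2) (c : 'I_(n1 * n2)) :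
  c = (j * n2 + l)%N :> nat -> character.trow A B k c = A 0 j * B k l.
Proof.
elim: n1 A j c => [|n1 IH] A j c; first by case: j.
move=> /= cE; rewrite [LHS]mxE; case: splitP => d dE.
  have j0 : j = 0 :> nat.
    have : (j * n2 + l < n2)%N by rewrite -cE dE.
    by case: (val j) => // j'; rewrite mulSn -addnA ltnNge leq_addr.
  rewrite !mxE; congr (A _ _ * B _ _); apply/val_inj => //=.
  by move: dE; rewrite /= cE j0 mul0n add0n.
have j_gt0 : (0 < j)%N.
  rewrite lt0n; apply: contraPneq (ltn_ord l) => j0.
  by move: dE; rewrite cE j0 mul0n add0n => ->; rewrite ltnNge leq_addr.
have j1 : (j.-1 < n1)%N by rewrite -ltnS prednK.
rewrite (IH _ (Ordinal j1)) /=; last first.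
  apply/eqP; rewrite -(eqn_add2l n2) addnA -mulSn prednK //.
  by rewrite -[(n2 + d)%N]dE cE.
rewrite !mxE; congr (A _ _ * _); apply/val_inj => //=.
by rewrite add1n prednK.
Qed.

Lemma kron_val m1 n1 m2 n2 (A : 'M[F]_(m1, n1)) (B : 'M[F]_(m2, n2))
    (i : 'I_m1) (j : 'I_n1) (k : 'I_m2) (l : 'I_n2)
    (r : 'I_(m1 * m2)) (c : 'I_(n1 * n2)) :
  r = (i * m2 + k)%N :> nat -> c = (j * n2 + l)%N :> nat ->
  kron A B r c = A i j * B k l.
Proof.
elim: m1 A i r => [|m1 IH] A i r; first by case: i.
move=> /= rE cE; rewrite [LHS]mxE; case: splitP => d dE.
  have i0 : i = 0 :> nat.
    have : (i * m2 + k < m2)%N by rewrite -rE dE.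
    by case: (val i) => // i'; rewrite mulSn -addnA ltnNge leq_addr.
  rewrite (trow_val _ _ _ cE) !mxE; congr (A _ _ * B _ _); apply/val_inj => //=.
  by move: dE; rewrite /= rE i0 mul0n add0n.
have i_gt0 : (0 < i)%N.
  rewrite lt0n; apply: contraPneq (ltn_ord k) => i0.
  by move: dE; rewrite rE i0 mul0n add0n => ->; rewrite ltnNge leq_addr.
have i1 : (i.-1 < m1)%N by rewrite -ltnS prednK.
rewrite (IH _ (Ordinal i1)) //=; last first.
  apply/eqP; rewrite -(eqn_add2l m2) addnA -mulSn prednK //.
  by rewrite -[(m2 + d)%N]dE rE.
rewrite !mxE; congr (A _ _ * _); apply/val_inj => //=.
by rewrite add1n prednK.
Qed.

Lemma kronE m1 n1 m2 n2 (A : 'M[F]_(m1, n1)) (B : 'M[F]_(m2, n2))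
    (i : 'I_m1) (j : 'I_n1) (k : 'I_m2) (l : 'I_n2) :
  kron A B (mxvec_index i k) (mxvec_index j l) = A i j * B k l.
Proof. by apply: kron_val; apply: val_mxvec_index. Qed.

End KroneckerEntries.

Section LinearSystems.

Variable R : realType.

Notation mu := (@lebesgue_measure R).

Definition qform n (M : 'M[R]_n) (v : 'cV[R]_n) : R := (v^T *m M *m v) 0 0.

Definition posdef n (M : 'M[R]_n) : Prop :=
  M^T = M /\ forall v : 'cV[R]_n, v != 0 -> 0 < qform M v.

(* Inputs and states are total functions on R, used only at times t >= 0. *)
Definition locally_square_integrable m (u : R -> 'cV[R]_m) : Prop :=
  forall i : 'I_m,
    measurable_fun (`[0, +oo[ : set R) (fun t : R => u t i 0) /\
    forall T : R, mu.-integrable `[0, T] (fun t : R => ((u t i 0) ^+ 2)%:E).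

(* Solutions of x' = A x + B u, x(0) = x0, in the sense of Caratheodory, i.e.
   in integral form: with a merely measurable input, the differential equation
   can be required only almost everywhere, for absolutely continuous x. *)
Definition solution n m (A : 'M[R]_n) (B : 'M[R]_(n, m))
    (x0 : 'cV[R]_n) (u : R -> 'cV[R]_m) (x : R -> 'cV[R]_n) : Prop :=
  forall (t : R) (i : 'I_n), 0 <= t ->
    let f s := (A *m x s + B *m u s) i 0 in
    mu.-integrable `[0, t] (EFin \o f) /\
    x t i 0 = x0 i 0 + \int[mu]_(s in `[0, t]) f s.

Definition controllable n m (A : 'M[R]_n) (B : 'M[R]_(n, m)) : Prop :=
  forall x0 x1 : 'cV[R]_n, exists (T : R) u x,
    [/\ 0 < T, locally_square_integrable u, solution A B x0 u x & x T = x1].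

Section Centroid.

Variables N n p : nat.

(* [block i v] is v_i in the stacked vector v = (v_1, ..., v_N); by
   [val_mxvec_index] its k-th entry is entry i * m + k of v, all
   indices counted from 0. *)
Definition block m (i : 'I_N) (v : 'cV[R]_(N * m)) : 'cV[R]_m :=
  \col_k v (mxvec_index i k) 0.

Definition output (x : 'cV[R]_(N * n)) : 'cV[R]_n := \sum_(i < N) block i x.

Variables (A : 'M[R]_n) (B : 'M[R]_(n, p)).

Definition stacked_solution :=
  solution (kron (1%:M : 'M[R]_N) A) (kron (1%:M : 'M[R]_N) B).

Variables (Q : 'M[R]_n) (Rw : 'M[R]_(N * p)).

Definition cost (u : R -> 'cV[R]_(N * p)) (x : R -> 'cV[R]_(N * n)) : \bar R :=
  (\int[mu]_(t in `[0%R, +oo[)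
     (qform Q (output (x t)) + qform Rw (u t))%:E)%E.

Definition optimal (x0 : 'cV[R]_(N * n))
    (u : R -> 'cV[R]_(N * p)) (x : R -> 'cV[R]_(N * n)) : Prop :=
  [/\ locally_square_integrable u, stacked_solution x0 u x &
    forall u' x', locally_square_integrable u' -> stacked_solution x0 u' x' ->
      (cost u x <= cost u' x')%E].

(* The feedback u = K y, from every initial state, has a closed-loop solution
   and every closed-loop solution is optimal. *)
Definition optimal_feedback (K : 'M[R]_(N * p, n)) : Prop :=
  forall x0 : 'cV[R]_(N * n),
    let closed_loop x := stacked_solution x0 (fun t => K *m output (x t)) x in
    (exists x, closed_loop x) /\
    forall x, closed_loop x -> optimal x0 (fun t => K *m output (x t)) x.

End Centroid.

(* 1_N (x) G; the cast identifies the column index types 1 * n and n. *)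
Definition ones_kron N n p (G : 'M[R]_(p, n)) : 'M[R]_(N * p, n) :=
  castmx (erefl (N * p)%N, mul1n n) (kron (const_mx 1 : 'cV[R]_N) G).

Definition riccati N n p (A : 'M[R]_n) (B : 'M[R]_(n, p)) (Q : 'M[R]_n)
    (W : 'M[R]_p) (P : 'M[R]_n) : Prop :=
  P *m A + A^T *m P - N%:R *: (P *m B *m invmx W *m B^T *m P) + Q = 0.

End LinearSystems.

(* Main.v *)
Require Import Defs.
From mathcomp Require Import all_boot all_order all_algebra.
From mathcomp Require Import all_classical all_reals all_analysis.
From mathcomp Require Import measurable_realfun lebesgue_integral_fubini.
From mathcomp Require Import ring lra.

Set Implicit Arguments.
Unset Strict Implicit.
Unset Printing Implicit Defensive.

Import Order.TTheory GRing.Theory Num.Theory.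
Import numFieldNormedType.Exports.

Local Open Scope classical_set_scope.
Local Open Scope ring_scope.

(** The output y solves y' = A y + Bt u with Bt = 1_N^T (x) B, and the cost
    only sees y and u, so the problem is the linear-quadratic regulator of
    (A, Bt).

    For symmetric P let ric P = P A + A^T P - P S P + Q ([riccati_map]), with
    S = Bt R^-1 Bt^T, and let K = - R^-1 Bt^T P.  Completing the square
    ([completed_square]) and integrating the derivative of y^T P y along a
    trajectory ([lqr_balance]) gives
    << y(T)^T P y(T) + int_0^T (y^T Q y + u^T R u)
       = y(0)^T P y(0) + int_0^T (y^T ric(P) y + (u - K y)^T R (u - K y)). >>
    If ric P = 0 and P >= 0, the feedback u = K y costs at most y(0)^T P y(0)
    ([lqr_cost_le]).  Conversely no input costs less, as soon as P >= 0 and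
    ric P >= 0 ([lqr_cost_ge]): along a cheaper trajectory y^T P y would stay
    above a positive constant, hence so would y^T Q y because Q > 0, and the
    cost would be infinite.

    A solution P of ric P = 0 is found by maximization.  The subsolutions,
    that is the P >= 0 with ric P >= 0, are bounded: y(0)^T P y(0) is at most
    the cost of steering y(0) to the origin, which controllability makes
    finite ([subsolution_trace_bounded]).  They form a compact set, on which
    the trace has a maximum; and a subsolution that is not a solution can be
    enlarged ([riccati_subsolution_improve]), so the maximum is a solution.
    It is positive definite because P v = 0 forces
    v^T Q v = v^T ric(P) v = 0.

    For R = I_N (x) W one has R^-1 Bt^T = 1_N (x) W^-1 B^T, hence
    S = N B W^-1 B^T, so that ric P = 0 is the stated equation and K the stated
    broadcast gain.  Uniqueness of P holds because y(0)^T P y(0) is the optimal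
    cost ([riccati_solution_unique]). *)

(** * Quadratic forms *)

Section BilinearForms.
Variable R : realType.
Implicit Types (m n : nat).

Definition bform m n (M : 'M[R]_(m, n)) (a : 'cV[R]_m) (b : 'cV[R]_n) : R :=
  (a^T *m M *m b) 0 0.

Lemma bformE m n (M : 'M[R]_(m, n)) a b :
  bform M a b = \sum_i \sum_j M i j * (a i 0 * b j 0).
Proof.
rewrite /bform !mxE exchange_big /=; apply: eq_bigr => j _.
rewrite !mxE mulr_suml; apply: eq_bigr => i _.
by rewrite !mxE mulrAC mulrC.
Qed.

Lemma qformE n (M : 'M[R]_n) v : qform M v = bform M v v.
Proof. by []. Qed.

Lemma bformDl m n (M : 'M[R]_(m, n)) a a' b :
  bform M (a + a') b = bform M a b + bform M a' b.
Proof. by rewrite /bform linearD !mulmxDl mxE. Qed.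

Lemma bformDr m n (M : 'M[R]_(m, n)) a b b' :
  bform M a (b + b') = bform M a b + bform M a b'.
Proof. by rewrite /bform mulmxDr mxE. Qed.

Lemma bformZl m n (M : 'M[R]_(m, n)) c a b :
  bform M (c *: a) b = c * bform M a b.
Proof. by rewrite /bform linearZ /= -!scalemxAl mxE. Qed.

Lemma bformZr m n (M : 'M[R]_(m, n)) c a b :
  bform M a (c *: b) = c * bform M a b.
Proof. by rewrite /bform -scalemxAr mxE. Qed.

Lemma bform0 m n (a : 'cV[R]_m) (b : 'cV[R]_n) : bform 0 a b = 0.
Proof. by rewrite /bform mulmx0 mul0mx mxE. Qed.

Lemma bform_mxD m n (M M' : 'M[R]_(m, n)) a b :
  bform (M + M') a b = bform M a b + bform M' a b.
Proof. by rewrite /bform mulmxDr mulmxDl mxE. Qed.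

Lemma bform_mxN m n (M : 'M[R]_(m, n)) a b :
  bform (- M) a b = - bform M a b.
Proof. by rewrite /bform mulmxN mulNmx mxE. Qed.

Lemma bform_mxB m n (M M' : 'M[R]_(m, n)) a b :
  bform (M - M') a b = bform M a b - bform M' a b.
Proof. by rewrite bform_mxD bform_mxN. Qed.

Lemma bform_mxZ m n (M : 'M[R]_(m, n)) c a b :
  bform (c *: M) a b = c * bform M a b.
Proof. by rewrite /bform -scalemxAr -scalemxAl mxE. Qed.

Lemma bform_tr m n (M : 'M[R]_(m, n)) a b : bform M^T a b = bform M b a.
Proof.
transitivity ((b^T *m M *m a)^T 0 0); last by rewrite mxE.
by rewrite /bform !trmx_mul trmxK mulmxA.
Qed.

Lemma bform_mull m n k (C : 'M[R]_(k, m)) (M : 'M[R]_(k, n)) a b :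
  bform M (C *m a) b = bform (C^T *m M) a b.
Proof. by rewrite /bform trmx_mul !mulmxA. Qed.

Lemma bform_mulr m n k (C : 'M[R]_(n, k)) (M : 'M[R]_(m, n)) a b :
  bform M a (C *m b) = bform (M *m C) a b.
Proof. by rewrite /bform !mulmxA. Qed.

Lemma bform_delta m n (M : 'M[R]_(m, n)) i j :
  bform M (delta_mx i 0) (delta_mx j 0) = M i j.
Proof. by rewrite /bform trmx_delta -rowE -colE !mxE. Qed.

Lemma bform1E n (v : 'cV[R]_n) : bform 1%:M v v = \sum_i v i 0 ^+ 2.
Proof. by rewrite /bform mulmx1 mxE; apply: eq_bigr => i _; rewrite mxE. Qed.

Lemma bform1_ge0 n (v : 'cV[R]_n) : 0 <= bform 1%:M v v.
Proof. by rewrite bform1E; apply: sumr_ge0 => i _; exact: sqr_ge0. Qed.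

Lemma bform1_eq0 n (v : 'cV[R]_n) : bform 1%:M v v = 0 -> v = 0.
Proof.
rewrite bform1E => /eqP; rewrite psumr_eq0; last by move=> i _; exact: sqr_ge0.
move=> /allP v0; apply/colP => i; rewrite mxE; apply/eqP.
by have := v0 i (mem_index_enum i); rewrite /= sqrf_eq0.
Qed.

Lemma bform_le_bform1 n (M : 'M[R]_n) :
  exists2 c, 0 < c & forall v, `|bform M v v| <= c * bform 1%:M v v.
Proof.
exists (1 + \sum_i \sum_j `|M i j|).
  by rewrite ltr_pwDl// !sumr_ge0// => i _; rewrite sumr_ge0.
move=> v; rewrite mulrDl mul1r ler_wpDl ?bform1_ge0// bformE mulr_suml.
apply: le_trans (ler_norm_sum _ _ _) _; apply: ler_sum => i _.
rewrite mulr_suml; apply: le_trans (ler_norm_sum _ _ _) _.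
apply: ler_sum => j _.
rewrite normrM ler_wpM2l// bform1E.
have sq k : v k 0 ^+ 2 <= \sum_l v l 0 ^+ 2.
  by rewrite (bigD1 k)//= lerDl sumr_ge0// => l _; exact: sqr_ge0.
have := sq i; have := sq j; rewrite ler_norml => hj hi; nra.
Qed.

Definition psd n (M : 'M[R]_n) : Prop := M^T = M /\ forall v, 0 <= bform M v v.

Lemma psd0 n : psd (0 : 'M[R]_n).
Proof. by split=> [|v]; rewrite ?trmx0 ?bform0. Qed.

Lemma posdef_psd n (M : 'M[R]_n) : posdef M -> psd M.
Proof.
move=> [MT M0]; split=> // v; have [->|v0] := eqVneq v 0.
  by rewrite /bform mulmx0 mxE.
exact/ltW/M0.
Qed.

Lemma psd_congr m n (M : 'M[R]_n) (C : 'M[R]_(n, m)) :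
  psd M -> psd (C^T *m M *m C).
Proof.
move=> [MT M0]; split; first by rewrite !trmx_mul trmxK MT mulmxA.
by move=> v; rewrite -bform_mulr -bform_mull.
Qed.

(** Expand 0 <= (v - s M v)^T M (v - s M v) and take s = 1 / c, where c bounds
    the form of M.  This inequality stands in for spectral theory below. *)
Lemma psd_mulmx_bound n (M : 'M[R]_n) : psd M ->
  exists2 c, 0 < c & forall v, bform 1%:M (M *m v) (M *m v) <= c * bform M v v.
Proof.
move=> [MT M0]; have [c c0 Mc] := bform_le_bform1 M; exists c => // v.
set w := M *m v.
have {}Mc : bform M w w <= c * bform 1%:M w w.
  by apply: le_trans (Mc w); exact: ler_norm.
have vw : bform M v w = bform 1%:M w w.
  by rewrite /w !bform_mulr !bform_mull mul1mx MT.
have wv : bform M w v = bform 1%:M w w by rewrite -MT bform_tr.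
have := M0 (v - c^-1 *: w).
rewrite -scaleNr !(bformDl, bformDr, bformZl, bformZr) vw wv.
set q := bform 1%:M w w in Mc *; set e := bform M v v => h.
have ci : c^-1 * c = 1 by rewrite mulVf// gt_eqF.
have cp : 0 < c^-1 by rewrite invr_gt0.
have : c^-1 * c^-1 * bform M w w <= c^-1 * q.
  rewrite -mulrA ler_pM2l// -(ler_pM2l c0) mulrA mulfV ?gt_eqF// mul1r//.
move=> h2; have : c^-1 * q <= e by nra.
by rewrite -(ler_pM2l c0) mulrA mulfV ?gt_eqF// mul1r.
Qed.

Lemma psd_ker n (M : 'M[R]_n) v : psd M -> bform M v v = 0 -> M *m v = 0.
Proof.
move=> /psd_mulmx_bound[c c0 /(_ v)]; move=> + v0; rewrite v0 mulr0 => le0.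
by apply: bform1_eq0; apply/eqP; rewrite eq_le le0 bform1_ge0.
Qed.

Lemma mulmx_ker0_unit n (M : 'M[R]_n) :
  (forall v : 'cV[R]_n, bform M v v = 0 -> v = 0) -> M \in unitmx.
Proof.
move=> ker0; rewrite -row_free_unit; apply/inj_row_free => v vM.
apply/trmx_inj; rewrite trmx0; apply: ker0.
by rewrite /bform trmxK vM mul0mx mxE.
Qed.

Lemma posdef_unit n (M : 'M[R]_n) : posdef M -> M \in unitmx.
Proof.
move=> [_ M0]; apply: mulmx_ker0_unit => v v0; apply/eqP/negP => /negP/M0.
by rewrite qformE v0 ltxx.
Qed.

Lemma psd_unit_posdef n (M : 'M[R]_n) :
  psd M -> (forall v : 'cV[R]_n, M *m v = 0 -> v = 0) -> posdef M.
Proof.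
move=> pM ker0; split=> [|v v0]; first exact: pM.1.
rewrite qformE lt_neqAle pM.2 andbT eq_sym; apply/eqP => Mv.
by move/eqP: v0; apply; exact/ker0/psd_ker.
Qed.

(** Apply [psd_mulmx_bound] to M, and write v = M^-1 (M v). *)
Lemma posdef_coercive n (M : 'M[R]_n) : posdef M ->
  exists2 c, 0 < c & forall v, bform 1%:M v v <= c * bform M v v.
Proof.
move=> pM; have [c1 c10 h1] := psd_mulmx_bound (posdef_psd pM).
have [c2 c20 h2] := @bform_le_bform1 n ((invmx M)^T *m invmx M).
exists (c2 * c1) => [|v]; first exact: mulr_gt0.
have -> : bform 1%:M v v = bform ((invmx M)^T *m invmx M) (M *m v) (M *m v).
  by rewrite -bform_mulr -[(invmx M)^T]mulmx1 -bform_mull mulKmx ?posdef_unit.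
rewrite -mulrA; apply: le_trans (_ : c2 * bform 1%:M (M *m v) (M *m v) <= _).
  exact: le_trans (ler_norm _) (h2 _).
by rewrite ler_pM2l.
Qed.

Lemma psd_trace_gt0 n (M : 'M[R]_n) : psd M -> M != 0 -> 0 < \tr M.
Proof.
move=> pM M0; have Mii i : 0 <= M i i by rewrite -bform_delta pM.2.
rewrite lt_neqAle sumr_ge0// andbT eq_sym; apply: contra_neq M0 => tr0.
apply/matrixP => i j; rewrite mxE.
have /psd_ker : bform M (delta_mx j 0) (delta_mx j 0) = 0.
  rewrite bform_delta; apply/eqP; move/eqP: tr0.
  by rewrite psumr_eq0// => /allP/(_ j (mem_index_enum j)).
by move=> /(_ pM); rewrite -colE => /colP/(_ i); rewrite !mxE.
Qed.

Lemma psd_entry_le_trace n (M : 'M[R]_n) i j : psd M -> `|M i j| <= \tr M.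
Proof.
move=> pM; have Mii k : 0 <= M k k by rewrite -bform_delta pM.2.
have Mtr k : M k k <= \tr M.
  by rewrite /mxtrace (bigD1 k)//= lerDl sumr_ge0.
have Mji : M j i = M i j by rewrite -[in RHS]pM.1 mxE.
have := pM.2 (delta_mx i 0 + delta_mx j 0).
have := pM.2 (delta_mx i 0 + (-1) *: delta_mx j 0).
rewrite !(bformDl, bformDr, bformZl, bformZr) !bform_delta Mji.
have := Mtr i; have := Mtr j; rewrite ler_norml => *; apply/andP; split; lra.
Qed.

End BilinearForms.

(** * Subsolutions of the Riccati equation *)

Section Riccati.
Variables (R : realType) (n : nat).
Implicit Types (A S Q P E : 'M[R]_n).

(** The residual of the algebraic Riccati equation; its nonnegativity singles
    out the subsolutions. *)
Definition riccati_map A S Q P := P *m A + A^T *m P - P *m S *m P + Q.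

Lemma riccati_map_tr A S Q P : S^T = S -> Q^T = Q -> P^T = P ->
  (riccati_map A S Q P)^T = riccati_map A S Q P.
Proof.
move=> ST QT PT; rewrite /riccati_map linearD /= linearB /= linearD /=.
rewrite !trmx_mul trmxK.
by rewrite ST QT PT mulmxA [_ *m A + _]addrC.
Qed.

(** The expansion is exact: the linear part at P is the Lyapunov operator of
    the closed-loop matrix A - S P, and the remainder is - E S E. *)
Lemma riccati_mapD A S Q P E : S^T = S -> P^T = P ->
  let Ac := A - S *m P in
  riccati_map A S Q (P + E) =
    riccati_map A S Q P + (E *m Ac + Ac^T *m E) - E *m S *m E.
Proof.
move=> ST PT Ac; have AcT : Ac^T = A^T - P *m S.
  by rewrite /Ac linearB /= trmx_mul ST PT.
rewrite /riccati_map AcT /Ac.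
rewrite !(mulmxDl, mulmxDr, mulmxN, mulNmx) !mulmxA.
rewrite !opprD !addrA.
set a := P *m A; set b := E *m A; set c := A^T *m P; set d := A^T *m E.
set e := P *m S *m P; set f := P *m S *m E; set g := E *m S *m P.
set h := E *m S *m E.
by apply/matrixP => i j; rewrite !(mxE _ _ i j); ring.
Qed.

(** With Ac = A - S P, D the residual at P and F = 1 - h Ac invertible, the
    solution E0 of F^T E0 F = D is nonnegative and satisfies
    << E0 Ac + Ac^T E0 = (E0 - D) / h + h Ac^T E0 Ac. >>
    Hence E = eps E0 with eps <= h has residual at least
    eps E0 / h - eps^2 E0 S E0.  As E0 S E0 <= c E0 by [psd_mulmx_bound], this
    is nonnegative for small eps. *)
Lemma riccati_subsolution_improve A S Q P :
  S^T = S -> Q^T = Q -> psd P -> psd (riccati_map A S Q P) ->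
  riccati_map A S Q P != 0 ->
  exists E, [/\ psd E, E != 0 & psd (riccati_map A S Q (P + E))].
Proof.
move=> ST QT pP pD D0; set D := riccati_map A S Q P in pD D0 *.
pose Ac := A - S *m P.
have [c c0 Acc] := bform_le_bform1 Ac.
(* The form of F is then at least half the squared norm, so F is invertible. *)
pose h := (2 * c)^-1.
have h0 : 0 < h by rewrite invr_gt0 mulr_gt0.
have hc : h * c = 2^-1 by rewrite /h invfM -mulrA mulVf ?mulr1// gt_eqF.
pose F := 1%:M - h *: Ac.
have Fu : F \in unitmx.
  apply: mulmx_ker0_unit => v; rewrite bform_mxB bform_mxZ => vF.
  apply: bform1_eq0; have := Acc v; have := bform1_ge0 v.
  rewrite ler_norml => v0 /andP[_].
  rewrite -(ler_pM2l h0) mulrA hc; move: vF v0.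
  set q := bform 1%:M v v; set r := h * bform Ac v v; lra.
pose E0 := (invmx F)^T *m D *m invmx F.
have pE0 : psd E0 by exact: psd_congr.
have FE0F : F^T *m E0 *m F = D.
  rewrite /E0 !mulmxA -trmx_mul mulVmx// trmx1 mul1mx.
  by rewrite -mulmxA mulVmx// mulmx1.
have lyap v : bform (E0 *m Ac + Ac^T *m E0) v v =
    h^-1 * (bform E0 v v - bform D v v) + h * bform E0 (Ac *m v) (Ac *m v).
  have hn : h != 0 by rewrite gt_eqF.
  rewrite bform_mxD -(bform_mulr Ac E0) -(bform_mull Ac E0) -FE0F.
  rewrite -(bform_mulr F) -(bform_mull F).
  have -> : F *m v = v + (- h) *: (Ac *m v).
    by rewrite [LHS]mulmxBl mul1mx -scalemxAl scaleNr.
  rewrite !(bformDl, bformDr, bformZl, bformZr).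
  by field.
have [s s0 Ss] := bform_le_bform1 S.
have [k k0 Ek] := psd_mulmx_bound pE0.
(* Both eps <= h and eps * s * k <= 1 / h. *)
pose eps := h / (1 + h ^+ 2 * (s * k)).
have den0 : 0 < 1 + h ^+ 2 * (s * k) by rewrite ltr_pwDl// !mulr_ge0// ltW.
have eps0 : 0 < eps by exact: divr_gt0.
exists (eps *: E0); split.
- split=> [|v]; first by rewrite linearZ /= pE0.1.
  by rewrite bform_mxZ mulr_ge0 ?pE0.2// ltW.
- rewrite scaler_eq0 gt_eqF//=; apply: contra_neq D0 => E00.
  by rewrite -FE0F E00 mulmx0 mul0mx.
split=> [|v].
  by rewrite riccati_map_tr// linearD linearZ /= pP.1 pE0.1.
rewrite riccati_mapD// -/D -/Ac; last exact: pP.1.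
rewrite -scalemxAl -scalemxAr -scalerDr bform_mxB bform_mxD bform_mxZ lyap.
rewrite -scalemxAl -scalemxAl -scalemxAr scalerA bform_mxZ.
have -> : bform (E0 *m S *m E0) v v = bform S (E0 *m v) (E0 *m v).
  by rewrite bform_mulr bform_mull pE0.1 mulmxA.
have h1 : bform S (E0 *m v) (E0 *m v) <= s * k * bform E0 v v.
  rewrite (le_trans (ler_norm _))// (le_trans (Ss _))// -mulrA.
  by rewrite ler_pM2l.
have := pE0.2 (Ac *m v); have := pE0.2 v; have := pD.2 v; move: h1.
set d := bform D v v; set e := bform E0 v v; set e' := bform E0 (Ac *m v) _.
set w := bform S _ _ => h1 d0 e0 e'0.
have hn : h != 0 by rewrite gt_eqF.
have eph : eps * (1 + h ^+ 2 * (s * k)) = h by rewrite divfK// gt_eqF.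
have hsk : 0 < h ^+ 2 * (s * k) by rewrite !mulr_gt0.
have ehi : eps * h^-1 <= 1.
  by rewrite ler_pdivrMr// mul1r -[leRHS]eph mulrDr mulr1 lerDl ltW// mulr_gt0.
have esk : eps * (s * k) <= h^-1.
  rewrite -(ler_pM2l (_ : 0 < h ^+ 2)) ?exprn_gt0// expr2 mulfK//.
  have -> : h * h * (eps * (s * k)) = eps * (h ^+ 2 * (s * k)) by ring.
  by rewrite -[leRHS]eph mulrDr mulr1 lerDr ltW.
have t1 : eps * (eps * w) <= eps * (h^-1 * e).
  rewrite ler_pM2l// (le_trans (_ : _ <= eps * (s * k * e)))//.
    by rewrite ler_wpM2l// ltW.
  by rewrite mulrA ler_wpM2r.
have t2 : eps * h^-1 * d <= d by rewrite ler_piMl.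
have t3 : 0 <= eps * (h * e').
  by apply: mulr_ge0; [exact: ltW|apply: mulr_ge0 => //; exact: ltW].
lra.
Qed.

Section MatrixContinuity.
Variable T : topologicalType.

Definition mxcontinuous m k (F : T -> 'M[R]_(m, k)) :=
  forall i j, continuous (fun v => F v i j).

Lemma mxcontinuous_cst m k (M : 'M[R]_(m, k)) : mxcontinuous (fun=> M).
Proof. by move=> i j; exact: cst_continuous. Qed.

Lemma mxcontinuousD m k (F G : T -> 'M[R]_(m, k)) :
  mxcontinuous F -> mxcontinuous G -> mxcontinuous (fun v => F v + G v).
Proof.
move=> cF cG i j v; under eq_fun do rewrite mxE.
by apply: cvgD; [exact: cF|exact: cG].
Qed.

Lemma mxcontinuousM m k l (F : T -> 'M[R]_(m, k)) (G : T -> 'M[R]_(k, l)) :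
  mxcontinuous F -> mxcontinuous G -> mxcontinuous (fun v => F v *m G v).
Proof.
move=> cF cG i j; under eq_fun do rewrite mxE.
apply: continuous_big => [|r _ v]; first exact: add_continuous.
by apply: cvgM; [exact: cF|exact: cG].
Qed.

Lemma mxcontinuousN m k (F : T -> 'M[R]_(m, k)) :
  mxcontinuous F -> mxcontinuous (fun v => - F v).
Proof.
by move=> cF i j v; under eq_fun do rewrite mxE; apply: cvgN; exact: cF.
Qed.

Lemma mxcontinuous_tr m k (F : T -> 'M[R]_(m, k)) :
  mxcontinuous F -> mxcontinuous (fun v => (F v)^T).
Proof. by move=> cF i j v; under eq_fun do rewrite mxE; exact: cF. Qed.

Lemma closed_psd m (F : T -> 'M[R]_m) :
  mxcontinuous F -> closed [set v | psd (F v)].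
Proof.
move=> cF.
have -> : [set v | psd (F v)] =
    (\bigcap_(ij in [set: 'I_m * 'I_m])
       [set v | ((F v)^T - F v) ij.1 ij.2 = 0]) `&`
    \bigcap_(w in [set: 'cV[R]_m]) [set v | 0 <= bform (F v) w w].
  apply/seteqP; split => [v [FT F0]|v [FT F0]].
    by split=> [[i j] _|w _] /=; [rewrite FT subrr mxE|exact: F0].
  split=> [|w]; last exact: F0.
  apply/eqP; rewrite -subr_eq0; apply/eqP/matrixP => i j.
  by rewrite (FT (i, j))// mxE.
apply: closedI.
  apply: closed_bigI => -[i j] _ /=.
  apply: (@preimage_closed _ _ (fun v => ((F v)^T - F v) i j) [set x | x = 0]).
    move=> v _; apply: mxcontinuousD; first exact: mxcontinuous_tr.
    exact: mxcontinuousN.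
  exact: closed_eq.
apply: closed_bigI => w _ /=.
have cb : mxcontinuous (fun v => w^T *m F v *m w).
  apply: mxcontinuousM; last exact: mxcontinuous_cst.
  by apply: mxcontinuousM => //; exact: mxcontinuous_cst.
apply: (@preimage_closed _ _ (fun v => bform (F v) w w) [set x | 0 <= x]).
  by move=> v _; exact: cb.
exact: closed_ge.
Qed.

End MatrixContinuity.

(** The subsolutions form a closed set containing 0, compact once the traces
    are bounded; a subsolution of maximal trace admits no improvement. *)
Lemma riccati_solution_of_bounded_subsolutions A S Q c : S^T = S -> psd Q ->
  (forall P, psd P -> psd (riccati_map A S Q P) -> \tr P <= c) ->
  exists2 P, psd P & riccati_map A S Q P = 0.
Proof.
move=> ST pQ trc.
pose Gam := [set v : 'rV[R]_(n * n) |
  psd (vec_mx v) /\ psd (riccati_map A S Q (vec_mx v))].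
have cvec : mxcontinuous (fun v : 'rV[R]_(n * n) => vec_mx v).
  move=> i j; under eq_fun do rewrite mxE; exact: coord_continuous.
have cric : mxcontinuous
    (fun v : 'rV[R]_(n * n) => riccati_map A S Q (vec_mx v)).
  have cst m k (M : 'M[R]_(m, k)) : mxcontinuous (fun _ : 'rV[R]_(n * n) => M).
    exact: mxcontinuous_cst.
  apply: mxcontinuousD => //; apply: mxcontinuousD; last first.
    by apply: mxcontinuousN; do 2 apply: mxcontinuousM => //.
  by apply: mxcontinuousD; exact: mxcontinuousM.
have clGam : closed Gam by apply: closedI; exact: closed_psd.
have bdGam : bounded_set Gam.
  exists c; split; first exact: num_real.
  move=> M cM v [pv rv]; rewrite /= [leLHS]/Num.norm /= mx_normrE.
  have M0 : 0 <= M.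
    rewrite ltW// (le_lt_trans _ cM)// (le_trans _ (trc _ pv rv))//.
    by apply: sumr_ge0 => i _; rewrite -bform_delta pv.2.
  apply/bigmax_leP; split => // -[i k] _ /=.
  case/mxvec_indexP: k => k l; rewrite (ord1 i) -[v]vec_mxK mxvecE.
  rewrite (le_trans (psd_entry_le_trace _ _ pv))// (le_trans (trc _ pv rv))//.
  exact: ltW.
have Gam0 : Gam !=set0.
  exists 0; rewrite /Gam /= linear0 /riccati_map.
  rewrite !(mul0mx, mulmx0) addr0 subrr add0r.
  by split => //; exact: psd0.
have ctr : {within Gam, continuous (fun v : 'rV[R]_(n * n) => \tr (vec_mx v))}.
  apply: continuous_subspaceT.
  by apply: continuous_big => [|i _]; [exact: add_continuous|exact: cvec].
have cGam : compact Gam := bounded_closed_compact bdGam clGam.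
have [v + vmax] := compact_EVT_max Gam0 cGam ctr.
rewrite inE => -[pv rv]; exists (vec_mx v) => //.
apply/eqP/negP => /negP ric0.
have [E [pE E0 rE]] := riccati_subsolution_improve ST pQ.1 pv rv ric0.
have : mxvec (vec_mx v + E) \in Gam.
  rewrite inE /Gam /= mxvecK; split=> //; split=> [|w].
    by rewrite linearD /= pv.1 pE.1.
  by rewrite bform_mxD addr_ge0 ?pv.2 ?pE.2.
move=> /vmax; rewrite mxvecK linearD /= gerDl leNgt.
by rewrite psd_trace_gt0.
Qed.

End Riccati.

(** * Stacked vectors and Kronecker products *)

Section Stacking.
Variable R : realType.
Variable N : nat.

(** The matrix 1_N^T (x) M, which maps (x_1, ..., x_N) to the sum of the
    M x_i. *)
Definition sum_blocks n k (M : 'M[R]_(n, k)) : 'M[R]_(n, N * k) :=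
  character.trow (const_mx 1 : 'rV[R]_N) M.

Lemma sum_blocksE n k (M : 'M[R]_(n, k)) r i j :
  sum_blocks M r (mxvec_index i j) = M r j.
Proof.
rewrite (trow_val _ _ _ (j := i) (l := j)) ?mxE ?mul1r//.
exact: val_mxvec_index.
Qed.

Lemma ones_kronE n p (G : 'M[R]_(p, n)) (i : 'I_N) (k : 'I_p) (j : 'I_n) :
  ones_kron N G (mxvec_index i k) j = G k j.
Proof.
rewrite castmxE cast_ord_id.
rewrite (kron_val _ _ (i := i) (j := 0) (k := k) (l := j)) ?mxE ?mul1r//.
exact: val_mxvec_index.
Qed.

Lemma sum_mxvec (V : nmodType) k (F : 'I_(N * k) -> V) :
  \sum_r F r = \sum_i \sum_j F (mxvec_index i j).
Proof.
rewrite pair_bigA /=; rewrite (reindex _ (curry_mxvec_bij N k)).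
by apply: eq_bigr => -[i j].
Qed.

Lemma output_mulmx n (x : 'cV[R]_(N * n)) : output x = sum_blocks 1%:M *m x.
Proof.
apply/colP => r; rewrite /output summxE mxE sum_mxvec; apply: eq_bigr => i _.
rewrite mxE (bigD1 r)//= big1 ?addr0 => [|j jr].
  by rewrite sum_blocksE mxE eqxx mul1r.
by rewrite sum_blocksE mxE eq_sym (negPf jr) mul0r.
Qed.

Lemma mulmx_sum_blocks n k l (D : 'M[R]_(l, n)) (M : 'M[R]_(n, k)) :
  D *m sum_blocks M = sum_blocks (D *m M).
Proof.
apply/matrixP => r c; case/mxvec_indexP: c => i j.
by rewrite sum_blocksE !mxE; apply: eq_bigr => s _; rewrite sum_blocksE.
Qed.

Lemma sum_blocks_kron n k l (M : 'M[R]_(n, k)) (D : 'M[R]_(k, l)) :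
  sum_blocks M *m kron (1%:M : 'M[R]_N) D = sum_blocks (M *m D).
Proof.
apply/matrixP => r c; case/mxvec_indexP: c => i j.
rewrite sum_blocksE !mxE sum_mxvec (bigD1 i)//= [X in _ + X]big1 ?addr0.
  by apply: eq_bigr => s _; rewrite sum_blocksE kronE mxE eqxx mul1r.
move=> i' ii'; apply: big1 => s _.
by rewrite kronE mxE (negPf ii') mul0r mulr0.
Qed.

Lemma kron_ones_kron n p q (W : 'M[R]_(q, p)) (G : 'M[R]_(p, n)) :
  kron (1%:M : 'M[R]_N) W *m ones_kron N G = ones_kron N (W *m G).
Proof.
apply/matrixP => r c; case/mxvec_indexP: r => i k.
rewrite ones_kronE !mxE sum_mxvec (bigD1 i)//= [X in _ + X]big1 ?addr0.
  by apply: eq_bigr => s _; rewrite ones_kronE kronE mxE eqxx mul1r.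
move=> i' ii'; apply: big1 => s _.
by rewrite kronE mxE eq_sym (negPf ii') !mul0r.
Qed.

Lemma sum_blocks_ones_kron n p q (M : 'M[R]_(q, p)) (G : 'M[R]_(p, n)) :
  sum_blocks M *m ones_kron N G = N%:R *: (M *m G).
Proof.
apply/matrixP => r c; rewrite !mxE sum_mxvec.
under eq_bigr => i _.
  under eq_bigr do rewrite sum_blocksE ones_kronE.
over.
by rewrite sumr_const card_ord mulr_natl.
Qed.

Lemma ones_kron_mulmx n p q (G : 'M[R]_(p, n)) (M : 'M[R]_(n, q)) :
  ones_kron N G *m M = ones_kron N (G *m M).
Proof.
apply/matrixP => r c; case/mxvec_indexP: r => i k.
by rewrite ones_kronE !mxE; apply: eq_bigr => s _; rewrite ones_kronE.
Qed.

Lemma sum_blocks_tr n p (M : 'M[R]_(n, p)) : (sum_blocks M)^T = ones_kron N M^T.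
Proof.
apply/matrixP => r c; case/mxvec_indexP: r => i k.
by rewrite ones_kronE !mxE sum_blocksE.
Qed.

Lemma block_ones_kron n p (G : 'M[R]_(p, n)) y i :
  block i (ones_kron N G *m y) = G *m y.
Proof.
apply/colP => k; rewrite !mxE; apply: eq_bigr => j _.
by rewrite ones_kronE.
Qed.

End Stacking.

(** * Integration by parts for absolutely continuous functions *)

Section Integrals.
Variable R : realType.
Notation mu := (@lebesgue_measure R).

Section EFin_integrable.
Variables (i : interval R) (f g : R -> R).
Hypothesis intf : mu.-integrable [set` i] (EFin \o f).

Lemma integrableD_EFin : mu.-integrable [set` i] (EFin \o g) ->
  mu.-integrable [set` i] (EFin \o (fun t => f t + g t)).
Proof.
move=> intg; have := @integrableD _ _ _ mu _ (measurable_itv i) _ _ intf intg.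
by apply: eq_integrable => // t _ /=; rewrite EFinD.
Qed.

Lemma integrableB_EFin : mu.-integrable [set` i] (EFin \o g) ->
  mu.-integrable [set` i] (EFin \o (fun t => f t - g t)).
Proof.
move=> intg; have := @integrableB _ _ _ mu _ (measurable_itv i) _ _ intf intg.
by apply: eq_integrable => // t _ /=; rewrite EFinB.
Qed.

Lemma integrableZl_EFin (c : R) :
  mu.-integrable [set` i] (EFin \o (fun t => c * f t)).
Proof.
have := @integrableZl _ _ _ mu _ (measurable_itv i) c _ intf.
by apply: eq_integrable => // t _ /=; rewrite EFinM.
Qed.

Lemma integrableZr_EFin (c : R) :
  mu.-integrable [set` i] (EFin \o (fun t => f t * c)).
Proof.
have := integrableZl_EFin c.
by apply: eq_integrable => // t _ /=; rewrite mulrC.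
Qed.

End EFin_integrable.

Lemma integrable_sum_EFin (i : interval R) (I : Type) (r : seq I)
    (f : I -> R -> R) :
  (forall k, mu.-integrable [set` i] (EFin \o f k)) ->
  mu.-integrable [set` i] (EFin \o (fun t => \sum_(k <- r) f k t)).
Proof.
move=> intf.
have := @integrable_sum _ _ _ mu _ (measurable_itv i) _ r xpredT
  (fun k => EFin \o f k) (fun k _ => intf k).
by apply: eq_integrable => // t _ /=; rewrite sumEFin.
Qed.

Lemma Rintegral_sum (i : interval R) (I : Type) (r : seq I)
    (f : I -> R -> R) :
  (forall k, mu.-integrable [set` i] (EFin \o f k)) ->
  \int[mu]_(t in [set` i]) (\sum_(k <- r) f k t)
  = \sum_(k <- r) \int[mu]_(t in [set` i]) f k t.
Proof.
move=> intf; elim: r => [|k r IH].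
  rewrite big_nil; under eq_Rintegral do rewrite big_nil.
  by rewrite Rintegral_cst ?mul0r.
rewrite big_cons -IH -RintegralD//; last exact: integrable_sum_EFin.
by apply: eq_Rintegral => t _; rewrite big_cons.
Qed.

Lemma within_continuous_bounded (a b : R) (F : R -> R) :
  {within `[a, b], continuous F} ->
  measurable_fun `[a, b]%classic F /\ [bounded F x | x in `[a, b]%classic].
Proof.
move=> cF; split; first exact: subspace_continuous_measurable_fun.
have := continuous_compact cF (@segment_compact _ a b).
move/compact_bounded => -[M [Mr FM]]; exists M; split => // x Mx y /= yab.
by apply: FM => //; exists y.
Qed.

Lemma integrableM_continuous (a b : R) (f F : R -> R) :
  mu.-integrable `[a, b] (EFin \o f) -> {within `[a, b], continuous F} ->
  mu.-integrable `[a, b] (EFin \o (fun t => f t * F t)).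
Proof.
move=> intf /within_continuous_bounded[mF bF].
have := @integrableMl _ _ _ mu _ (measurable_itv `[a, b]) _ F intf mF bF.
by apply: eq_integrable => // t _ /=; rewrite EFinM.
Qed.

Lemma integrable_sub0 (f : R -> R) (t T : R) : t <= T ->
  mu.-integrable `[0, T] (EFin \o f) -> mu.-integrable `[0, t] (EFin \o f).
Proof.
move=> tT; apply: integrableS => //; apply: subset_itvl.
by rewrite bnd_simp.
Qed.

Lemma itv0y_bigcup : `[0, +oo[%classic = \bigcup_k `[0, k%:R]%classic :> set R.
Proof.
apply/seteqP; split => [t /=|t [k _] /=]; rewrite !in_itv /=.
  rewrite andbT => t0; exists (Num.truncn t).+1 => //=.
  by rewrite in_itv /= t0 ltW// truncnS_gt.
by move=> /andP[->].
Qed.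

Let integrable_patch (i : interval R) (f : R -> R) :
  mu.-integrable [set` i] (EFin \o f) ->
  mu.-integrable [set: measurableTypeR R] ((EFin \o f) \_ [set` i]).
Proof. exact: (@integrable_mkcond _ _ _ mu _ _ (measurable_itv _)).1. Qed.

(** Fubini on the triangle s <= t of the square [0, T]^2, for the integrable
    function (t, s) |-> f t * g s.  The integrands are merely integrable, hence
    integration by parts for C^1 functions does not apply. *)
Lemma Rintegral_mulr_parts (f g : R -> R) (T : R) : 0 <= T ->
  mu.-integrable `[0, T] (EFin \o f) -> mu.-integrable `[0, T] (EFin \o g) ->
  let F t := \int[mu]_(s in `[0, t]) f s in
  let G t := \int[mu]_(s in `[0, t]) g s in
  \int[mu]_(s in `[0, T]) (f s * G s) + \int[mu]_(s in `[0, T]) (g s * F s)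
   = F T * G T.
Proof.
move=> T0 intf intg F G.
pose D : set R := `[0, T]%classic.
have mD : measurable (D : set (measurableTypeR R)) by exact: measurable_itv.
pose f1 := f \_ D; pose g1 := g \_ D.
have if1 : mu.-integrable [set: measurableTypeR R] (EFin \o f1).
  rewrite /f1 -restrict_EFin; exact: integrable_patch.
have ig1 : mu.-integrable [set: measurableTypeR R] (EFin \o g1).
  rewrite /g1 -restrict_EFin; exact: integrable_patch.
have mf1 : measurable_fun [set: measurableTypeR R] f1.
  by have /integrableP[/measurable_EFinP] := if1.
have mg1 : measurable_fun [set: measurableTypeR R] g1.
  by have /integrableP[/measurable_EFinP] := ig1.
(* Integrating h first in one variable, then in the other, gives both sides. *)
pose h (z : measurableTypeR R * measurableTypeR R) : R :=
  f1 z.1 * g1 z.2 * (if z.2 <= z.1 then 1 else 0).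
have mh : measurable_fun [set: (measurableTypeR R * measurableTypeR R)%type]
    (EFin \o h).
  apply/measurable_EFinP; apply: measurable_funM.
    by apply: measurable_funM; apply: measurableT_comp.
  apply: measurable_fun_ifT => //.
  exact: measurable_fun_ler.
have ih : (mu \x mu)%E.-integrable
    [set: (measurableTypeR R * measurableTypeR R)%type] (EFin \o h).
  apply/(integrable12ltyP mu mu mh).
  have mcond (x : R) : measurable_fun [set: measurableTypeR R]
      (fun y => f1 x * g1 y * (if y <= x then 1 else 0)).
    apply: measurable_funM; first exact: measurable_funM.
    by apply: measurable_fun_ifT => //; exact: measurable_fun_ler.
  apply: (@le_lt_trans _ _ (\int[mu]_x (`|f1 x|%:E * \int[mu]_y `|g1 y|%:E))%E).
    apply: ge0_le_integral => //.
    - by move=> x _; exact: integral_ge0.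
    - apply: (@measurable_fun_fubini_tonelli_F _ _ (measurableTypeR R)
        (measurableTypeR R) R mu (abse \o (EFin \o h))).
        exact: measurableT_comp.
      by move=> z; exact: abse_ge0.
    - apply: emeasurable_funM; last exact: measurable_cst.
      by do 2 apply: measurableT_comp => //.
    - move=> x _; rewrite -ge0_integralZl//=; last first.
        by apply: measurableT_comp => //; apply: measurableT_comp.
      apply: ge0_le_integral => //=.
      + by do 2 apply: measurableT_comp => //; exact: mcond.
      + apply: measurable_funeM; do 2 apply: measurableT_comp => //.
      + move=> y _; rewrite -EFinM lee_fin /h /= !normrM.
        by case: ifP => _; rewrite ?normr1 ?normr0 ?mulr1// mulr0 mulr_ge0.
  rewrite ge0_integralZr//; last 2 first.
  - by do 2 apply: measurableT_comp => //.
  - exact: integral_ge0.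
  have /integrableP[_ fl] := if1; have /integrableP[_ gl] := ig1.
  by rewrite lte_mul_pinfty// ?integral_ge0// ge0_fin_numE// integral_ge0.
have hx x : (\int[mu]_y (h (x, y))%:E)%E = (f1 x * G x)%:E.
  have [xD|xD] := boolP (x \in D); last first.
    rewrite /h /f1 /= patchE (negbTE xD) /= mul0r.
    by under eq_integral do rewrite !mul0r; rewrite integral0.
  have /andP[x0 xT] : 0 <= x <= T by move: xD; rewrite inE /D /= in_itv.
  have ig : mu.-integrable `[0, x] (EFin \o g).
    exact: integrable_sub0 xT intg.
  transitivity (\int[mu]_y ((f1 x)%:E * ((EFin \o g) \_ `[0%R, x]) y))%E.
    apply: eq_integral => y _; rewrite restrict_EFin /h /= -EFinM; congr EFin.
    rewrite -mulrA; congr (_ * _); rewrite /g1 !patchE !mem_setE !in_itv /=.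
    case: (leP 0 y) => //= y0; last by rewrite mul0r.
    by case: (leP y x) => [yx|_]; rewrite ?mulr0// mulr1 (le_trans yx xT).
  rewrite integralZl//; last exact: integrable_patch.
  by rewrite EFinM -integral_mkcond /G fineK//; exact: integrable_fin_num.
have hy y : (\int[mu]_x (h (x, y))%:E)%E = (g1 y * (F T - F y))%:E.
  have [yD|yD] := boolP (y \in D); last first.
    rewrite /h /g1 /= patchE (negbTE yD) /= mul0r.
    by under eq_integral do rewrite mulr0 mul0r; rewrite integral0.
  have /andP[y0 yT] : 0 <= y <= T by move: yD; rewrite inE /D /= in_itv.
  have ify : mu.-integrable `[y, T] (EFin \o f).
    by apply: integrableS intf => //; apply: subset_itvr; rewrite bnd_simp.
  transitivity (\int[mu]_x ((g1 y)%:E * ((EFin \o f) \_ `[y, T]) x))%E.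
    apply: eq_integral => x _; rewrite restrict_EFin /h /= -EFinM; congr EFin.
    rewrite mulrAC mulrC; congr (_ * _).
    rewrite /f1 !patchE !mem_setE !in_itv /=.
    case: (leP y x) => /= [yx|_]; last by rewrite mulr0.
    by rewrite mulr1 (le_trans y0 yx).
  rewrite integralZl//; last exact: integrable_patch.
  have <- : \int[mu]_(x in `[y, T]) f x = F T - F y.
    rewrite -Rintegral_itv_obnd_cbnd.
      by rewrite /F Rintegral_itvB ?bnd_simp.
    by apply: integrableS ify => //; apply: subset_itvr; rewrite bnd_simp.
  by rewrite EFinM -integral_mkcond fineK//; exact: integrable_fin_num.
have := Fubini ih.
under eq_integral do rewrite hx.
under [in RHS]eq_integral do rewrite hy.
have EP (u v : R -> R) : (\int[mu]_x ((u \_ D) x * v x)%:E =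
    \int[mu]_(x in D) (u x * v x)%:E)%E.
  rewrite [RHS]integral_mkcond; apply: eq_integral => x _.
  by rewrite restrict_EFin /= !patchE; case: ifP => // _; rewrite mul0r.
rewrite !EP => /(congr1 fine); rewrite -!/(Rintegral _ _ _) => ->.
have intgF : mu.-integrable `[0, T] (EFin \o (fun s => g s * F s)).
  apply: integrableM_continuous => //; exact: parameterized_integral_continuous.
rewrite -RintegralD//; last first.
  have : mu.-integrable `[0, T] (EFin \o (fun s => g s * F T - g s * F s)).
    apply: integrableB_EFin intgF.
    exact: integrableZr_EFin.
  by apply: eq_integrable => // s _ /=; rewrite mulrBr.
under eq_Rintegral do rewrite -mulrDr subrK.
by rewrite RintegralZr// mulrC.
Qed.

End Integrals.

(** * Trajectories *)

Section Primitives.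
Variable R : realType.
Notation mu := (@lebesgue_measure R).

(** Absolutely continuous x with x(0) = x0 and x' = f almost everywhere on the
    half-line of nonnegative times; [solution] is the case f = A x + B u. *)
Definition primitive m (x0 : 'cV[R]_m) (f x : R -> 'cV[R]_m) : Prop :=
  forall (t : R) (i : 'I_m), 0 <= t ->
    mu.-integrable `[0, t] (EFin \o (fun s => f s i 0)) /\
    x t i 0 = x0 i 0 + \int[mu]_(s in `[0, t]) f s i 0.

Lemma solution_primitive m k (A : 'M[R]_m) (B : 'M[R]_(m, k)) x0 u x :
  solution A B x0 u x -> primitive x0 (fun t => A *m x t + B *m u t) x.
Proof. by move=> sol t i t0; exact: sol. Qed.

Lemma primitive_solution m k (A : 'M[R]_m) (B : 'M[R]_(m, k)) x0 u x :
  primitive x0 (fun t => A *m x t + B *m u t) x -> solution A B x0 u x.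
Proof. by move=> px t i t0; exact: px. Qed.

Lemma primitive_continuous m x0 (f x : R -> 'cV[R]_m) T i :
  primitive x0 f x -> 0 <= T -> {within `[0, T], continuous (fun t => x t i 0)}.
Proof.
move=> px T0.
have c : {within `[0, T], continuous
    (fun t => x0 i 0 + \int[mu]_(s in `[0, t]) f s i 0)}.
  move=> t; apply: cvgD; first exact: cst_continuous.
  by apply: parameterized_integral_continuous => //; have [] := px T i T0.
apply: subspace_eq_continuous c => t; rewrite inE /= in_itv /= => /andP[t0 _].
exact: (esym (px t i t0).2).
Qed.

Lemma primitive_mulmx m n (C : 'M[R]_(n, m)) x0 (f x : R -> 'cV[R]_m) :
  primitive x0 f x ->
  primitive (C *m x0) (fun t => C *m f t) (fun t => C *m x t).
Proof.
move=> px t i t0.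
have intf k := (px t k t0).1.
have E : (fun s => (C *m f s) i 0) = (fun s => \sum_k C i k * f s k 0).
  by apply/funext => s; rewrite mxE.
rewrite E; split.
  apply: integrable_sum_EFin => k; exact: integrableZl_EFin.
rewrite Rintegral_sum; last by move=> k; exact: integrableZl_EFin.
rewrite !mxE -big_split /=; apply: eq_bigr => k _.
by rewrite (px t k t0).2 mulrDr RintegralZl.
Qed.

(** The product rule, in integral form, for two coordinates of x. *)
Lemma primitiveM m x0 (f x : R -> 'cV[R]_m) T i j :
  primitive x0 f x -> 0 <= T ->
  mu.-integrable `[0, T]
    (EFin \o (fun s => f s i 0 * x s j 0 + x s i 0 * f s j 0)) /\
  x T i 0 * x T j 0 = x0 i 0 * x0 j 0
    + \int[mu]_(s in `[0, T]) (f s i 0 * x s j 0 + x s i 0 * f s j 0).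
Proof.
move=> px T0.
have intf k := (px T k T0).1.
have int2 k l : mu.-integrable `[0, T] (EFin \o (fun s => f s k 0 * x s l 0)).
  by apply: integrableM_continuous => //; exact: primitive_continuous px T0.
have int2' : mu.-integrable `[0, T] (EFin \o (fun s => x s i 0 * f s j 0)).
  by apply: eq_integrable (int2 j i) => // s _ /=; rewrite mulrC.
split; first exact: integrableD_EFin.
pose F k t := \int[mu]_(s in `[0, t]) f s k 0.
have intF k l : mu.-integrable `[0, T] (EFin \o (fun s => f s k 0 * F l s)).
  apply: integrableM_continuous => //.
  exact: parameterized_integral_continuous.
have split_int k l : \int[mu]_(s in `[0, T]) (f s k 0 * x s l 0) =
    F k T * x0 l 0 + \int[mu]_(s in `[0, T]) (f s k 0 * F l s).
  rewrite -RintegralZr// -RintegralD//; last first.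
    exact: (integrableZr_EFin (intf k)).
  apply: eq_Rintegral => s; rewrite inE /= in_itv /= => /andP[s0 _].
  by rewrite (px s l s0).2 mulrDr.
rewrite RintegralD// [X in _ + (_ + X)](_ : _ =
  \int[mu]_(s in `[0, T]) (f s j 0 * x s i 0)); last first.
  by apply: eq_Rintegral => s _; rewrite mulrC.
rewrite !split_int (px T i T0).2 (px T j T0).2 -/(F i T) -/(F j T).
have := Rintegral_mulr_parts T0 (intf i) (intf j).
rewrite /= -/(F i T) -/(F j T) => parts.
set I1 := \int[mu]_(s in _) (f s i 0 * F j s).
set I2 := \int[mu]_(s in _) (f s j 0 * F i s).
have {parts} : I1 + I2 = F i T * F j T by exact: parts.
by move=> e; lra.
Qed.

Lemma primitive_qform m (P : 'M[R]_m) x0 (f x : R -> 'cV[R]_m) T :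
  primitive x0 f x -> 0 <= T ->
  let q s := bform P (f s) (x s) + bform P (x s) (f s) in
  mu.-integrable `[0, T] (EFin \o q) /\
  qform P (x T) = qform P x0 + \int[mu]_(s in `[0, T]) q s.
Proof.
move=> px T0 q.
have int i j := (primitiveM i j px T0).1.
have -> : q = fun s => \sum_i \sum_j
    P i j * (f s i 0 * x s j 0 + x s i 0 * f s j 0).
  apply/funext => s; rewrite /q !bformE -big_split /=; apply: eq_bigr => i _.
  by rewrite -big_split /=; apply: eq_bigr => j _; rewrite mulrDr.
split.
  by do 2 apply: integrable_sum_EFin => ?; exact: integrableZl_EFin.
rewrite Rintegral_sum; last first.
  by move=> i; apply: integrable_sum_EFin => ?; exact: integrableZl_EFin.
rewrite !qformE !bformE -big_split /=; apply: eq_bigr => i _.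
rewrite Rintegral_sum; last by move=> j; exact: integrableZl_EFin.
rewrite -big_split /=; apply: eq_bigr => j _.
by rewrite RintegralZl// (primitiveM i j px T0).2 mulrDr.
Qed.

End Primitives.

Section LocallySquareIntegrable.
Variable R : realType.
Notation mu := (@lebesgue_measure R).

(** By continuity of x. *)
Lemma primitive_lsi m x0 (f x : R -> 'cV[R]_m) :
  primitive x0 f x -> locally_square_integrable x.
Proof.
move=> px i; split.
  rewrite itv0y_bigcup.
  apply/measurable_fun_bigcup => // k.
  apply: subspace_continuous_measurable_fun => //.
  exact: primitive_continuous px _.
move=> T; have [T0|T0] := leP 0 T; last first.
  rewrite set_itv_ge ?bnd_simp -?ltNge//; exact: integrable_set0.
have cx := primitive_continuous (i := i) px T0.
apply: continuous_compact_integrable; first exact: segment_compact.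
have -> : (fun t => x t i 0 ^+ 2) = (fun t => x t i 0 * x t i 0).
  by apply/funext => t; rewrite expr2.
by move=> t; apply: cvgM; exact: cx.
Qed.

Variables (m : nat) (u : R -> 'cV[R]_m).
Hypothesis lu : locally_square_integrable u.

Let mu_itv T i : measurable_fun (`[0, T]%classic : set R) (fun t => u t i 0).
Proof.
apply: measurable_funS (lu i).1 => //.
by apply: subset_itvl; rewrite bnd_simp.
Qed.

Lemma lsi_bform_measurable (M : 'M[R]_m) :
  measurable_fun (`[0, +oo[%classic : set R) (fun t => bform M (u t) (u t)).
Proof.
have -> : (fun t => bform M (u t) (u t)) =
    (fun t => \sum_i \sum_j M i j * (u t i 0 * u t j 0)).
  by apply/funext => t; rewrite bformE.
apply: measurable_sum => i; apply: measurable_sum => j.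
by apply: measurable_funM => //; apply: measurable_funM; exact: (lu _).1.
Qed.

(** By |u_i u_j| <= u_i^2 + u_j^2. *)
Lemma lsi_bform_integrable (M : 'M[R]_m) T :
  mu.-integrable `[0, T] (EFin \o (fun t => bform M (u t) (u t))).
Proof.
have -> : (fun t => bform M (u t) (u t)) =
    (fun t => \sum_i \sum_j M i j * (u t i 0 * u t j 0)).
  by apply/funext => t; rewrite bformE.
apply: integrable_sum_EFin => i; apply: integrable_sum_EFin => j.
apply: integrableZl_EFin.
have intD : mu.-integrable `[0, T]
    (EFin \o (fun t => u t i 0 ^+ 2 + u t j 0 ^+ 2)).
  by apply: integrableD_EFin; exact: (lu _).2.
apply: le_integrable intD => //.
  by apply/measurable_EFinP; apply: measurable_funM; exact: mu_itv.
move=> t _ /=; rewrite lee_fin [leRHS]ger0_norm ?addr_ge0 ?sqr_ge0//.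
rewrite ler_norml; apply/andP; split; nra.
Qed.

(** The square of a coordinate of C u is itself a quadratic form in u. *)
Lemma lsi_mulmx k (C : 'M[R]_(k, m)) :
  locally_square_integrable (fun t => C *m u t).
Proof.
move=> i; split.
  have -> : (fun t => (C *m u t) i 0) = (fun t => \sum_j C i j * u t j 0).
    by apply/funext => t; rewrite mxE.
  apply: measurable_sum => j; apply: measurable_funM => //; exact: (lu j).1.
move=> T; have := lsi_bform_integrable (C^T *m delta_mx i i *m C) T.
apply: eq_integrable => // t _ /=; congr EFin.
rewrite -bform_mulr -bform_mull bformE (bigD1 i)//= (bigD1 i)//= big1.
  rewrite [X in _ + X]big1 ?addr0 => [|j /negPf ji].
    by rewrite mxE !eqxx mul1r expr2.
  by rewrite big1// => l _; rewrite mxE ji mul0r.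
by move=> j /negPf ji; rewrite mxE ji andbF mul0r.
Qed.

End LocallySquareIntegrable.

Section LinearODE.
Variables (R : realType) (m : nat) (M : 'M[R]_m).
Notation mu := (@lebesgue_measure R).
Implicit Types (v : 'cV[R]_m).

Let cf v (i : 'I_m) : R^nat := fun k => iter k (mulmx M) v i 0 / k`!%:R.
Let flow v t : 'cV[R]_m := \col_i limn (pseries (cf v i) t).

(** This turns the formal derivative of the series into the equation
    x' = M x. *)
Let diffs_cf v i : pseries_diffs (cf v i) = cf (M *m v) i.
Proof.
apply/funext => k; rewrite /pseries_diffs /cf iterSr factS natrM invfM.
rewrite mulrC -mulrA; congr (_ * _).
by rewrite mulrAC mulVf ?mul1r// pnatr_eq0.
Qed.

(** The l1 norm of M^k v is at most C^k times that of v, where C is the sum of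
    the |M i j|; compare with the exponential series of C |t|. *)
Let cvg_cf v i t : cvgn (pseries (cf v i) t).
Proof.
pose C := \sum_i \sum_j `|M i j|.
pose b (w : 'cV[R]_m) : R := \sum_i `|w i 0|.
have bM (w : 'cV[R]_m) : b (M *m w) <= C * b w.
  rewrite /C /b mulr_suml; apply: ler_sum => r _.
  rewrite mxE mulr_suml; apply: le_trans (ler_norm_sum _ _ _) _.
  apply: ler_sum => j _; rewrite normrM ler_wpM2l// (bigD1 j)//= lerDl.
  exact: sumr_ge0.
have C0 : 0 <= C by rewrite /C; apply: sumr_ge0 => *; exact: sumr_ge0.
have biter k : b (iter k (mulmx M) v) <= C ^+ k * b v.
  elim: k => [|k IH]; first by rewrite expr0 mul1r.
  by rewrite iterS (le_trans (bM _))// exprS -mulrA ler_wpM2l.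
apply: normed_cvg.
apply: (@series_le_cvg _ _ (fun k => b v * exp_coeff (C * `|t|) k)).
- by move=> k /=.
- move=> k; rewrite mulr_ge0 ?sumr_ge0// exp_coeff_ge0// mulr_ge0//.
- move=> k /=; rewrite /cf /exp_coeff /= !normrM exprMn normrX.
  rewrite [`|(k`!%:R)^-1|]ger0_norm ?invr_ge0//.
  have vb : `|iter k (mulmx M) v i 0| <= C ^+ k * b v.
    apply: le_trans (biter k); rewrite /b (bigD1 i)//= lerDl.
    exact: sumr_ge0.
  have -> : b v * (C ^+ k * `|t| ^+ k / k`!%:R) =
      C ^+ k * b v / k`!%:R * `|t| ^+ k by ring.
  by rewrite !ler_wpM2r.
by apply: is_cvg_seriesZ; exact: is_cvg_series_exp_coeff.
Qed.

Let flow_mulmx v t : flow (M *m v) t = M *m flow v t.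
Proof.
apply/colP => i; rewrite !mxE.
apply: cvg_lim => //.
have -> : pseries (cf (M *m v) i) t =
    (fun k => \sum_j M i j * pseries (cf v j) t k).
  apply/funext => k; rewrite /pseries /series /=.
  under [RHS]eq_bigr do rewrite mulr_sumr.
  rewrite exchange_big /=; apply: eq_bigr => l _.
  rewrite /cf -iterSr iterS mxE !mulr_suml; apply: eq_bigr => j _.
  by rewrite !mulrA.
apply: cvg_big => [|j _]; first exact: add_continuous.
by rewrite mxE; apply: cvgMr; exact: cvg_cf.
Qed.

Let flow0 v : flow v 0 = v.
Proof.
apply/colP => i; rewrite mxE; apply: cvg_lim => //.
rewrite -cvg_shiftS /=; apply: cvg_near_cst; near=> k.
rewrite /pseries /series /= big_nat_recl//= expr0 mulr1 big1 ?addr0.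
  by rewrite /cf /= fact0 divr1.
by move=> j _; rewrite expr0n mulr0.
Unshelve. all: by end_near. Qed.

Let flow_is_derive v i (t : R) :
  is_derive t (1 : R) (fun s => flow v s i 0) (flow (M *m v) t i 0).
Proof.
have -> : (fun s => flow v s i 0) = (fun s => limn (pseries (cf v i) s)).
  by apply/funext => s; rewrite mxE.
rewrite mxE -diffs_cf; apply: (@pseries_snd_diffs _ _ (`|t| + 1)).
- exact: cvg_cf.
- by rewrite diffs_cf; exact: cvg_cf.
- by rewrite !diffs_cf; exact: cvg_cf.
- by rewrite [ltRHS]ger0_norm ?addr_ge0// ltrDl.
Qed.

(** The exponential series of t M applied to v, differentiated term by term
    coordinatewise. *)
Lemma linear_flow_exists v :
  exists x, primitive v (fun t => M *m x t) x.
Proof.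
exists (flow v) => t i t0.
have cont w : continuous (fun s => flow w s i 0).
  move=> s; apply: differentiable_continuous; apply/derivable1_diffP.
  by have [] := flow_is_derive w i s.
have -> : (fun s => (M *m flow v s) i 0) = (fun s => flow (M *m v) s i 0).
  by apply/funext => s; rewrite flow_mulmx.
have int : mu.-integrable `[0, t]
    (EFin \o (fun s => flow (M *m v) s i 0)).
  apply: continuous_compact_integrable; first exact: segment_compact.
  exact: continuous_subspaceT.
split=> //.
move: t0; rewrite le_eqVlt => /predU1P[<-|t0].
  by rewrite set_itv1 Rintegral_set1 addr0 flow0.
rewrite /Rintegral (continuous_FTC2 t0 (F := fun s => flow v s i 0)).
- by rewrite -EFinB /= flow0 addrC subrK.
- exact: continuous_subspaceT.
- split.
  + by move=> s _; have [] := flow_is_derive v i s.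
  + by apply: cvg_at_right_filter; exact: cont.
  + by apply: cvg_at_left_filter; exact: cont.
- by move=> s _; rewrite derive1E; have [_ ->] := flow_is_derive v i s.
Qed.

End LinearODE.

(** * The linear-quadratic regulator *)

Section ImproperIntegrals.
Variable R : realType.
Notation mu := (@lebesgue_measure R).
Variable l : R -> R.
Hypothesis l0 : forall t, 0 <= l t.
Hypothesis ml : measurable_fun (`[0, +oo[%classic : set R) l.
Hypothesis il : forall T, mu.-integrable `[0, T] (EFin \o l).

Lemma improper_integral_ge (T : R) :
  ((\int[mu]_(t in `[0, T]) l t)%:E <= \int[mu]_(t in `[0%R, +oo[) (l t)%:E)%E.
Proof.
rewrite /Rintegral fineK; last exact: integrable_fin_num.
apply: ge0_subset_integral => //=.
- exact/measurable_EFinP.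
- by move=> t _; rewrite lee_fin.
- by apply: subset_itvl; rewrite bnd_simp.
Qed.

Lemma improper_integral_le (c : R) :
  (forall T, 0 <= T -> \int[mu]_(t in `[0, T]) l t <= c) ->
  (\int[mu]_(t in `[0%R, +oo[) (l t)%:E <= c%:E)%E.
Proof.
move=> lc.
rewrite itv0y_bigcup.
have cvgl : (\int[mu]_(t in `[0%R, k%:R]) (l t)%:E @[k --> \oo] -->
    \int[mu]_(t in \bigcup_k `[0%R, k%:R]%classic) (l t)%:E)%E.
  apply: ge0_nondecreasing_set_cvg_integral.
  - move=> j k jk; apply/subsetPset; apply: subset_itvl.
    by rewrite bnd_simp ler_nat.
  - by move=> k; exact: measurable_itv.
  - by move=> k; have /integrableP[] := il k%:R.
  - by move=> k t _; rewrite lee_fin.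
rewrite -(cvg_lim _ cvgl)//; apply: lime_le.
  by apply/cvg_ex; eexists; exact: cvgl.
apply: nearW => k; rewrite -[leLHS]fineK; last exact: integrable_fin_num.
by rewrite lee_fin; exact: lc.
Qed.

End ImproperIntegrals.

Section LinearQuadraticRegulator.
Variables (R : realType) (n m : nat).
Notation mu := (@lebesgue_measure R).
Variables (A : 'M[R]_n) (B : 'M[R]_(n, m)) (Q : 'M[R]_n) (Rw : 'M[R]_m).
Hypothesis pQ : posdef Q.
Hypothesis pR : posdef Rw.

Let S := B *m invmx Rw *m B^T.
Definition lqr_gain (P : 'M[R]_n) : 'M[R]_(m, n) := - (invmx Rw *m B^T *m P).
Notation rate y u := (fun t : R => qform Q (y t) + qform Rw (u t)).

Lemma lqr_weight_sym : S^T = S.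
Proof. by rewrite /S !trmx_mul trmxK trmx_inv pR.1 mulmxA. Qed.

(** The left-hand side is the derivative of y^T P y plus the running cost; the
    gain is characterized by R K = - B^T P, so that K^T R K = P S P. *)
Lemma completed_square P y u : P^T = P ->
  bform P (A *m y + B *m u) y + bform P y (A *m y + B *m u)
    + (qform Q y + qform Rw u)
  = qform (riccati_map A S Q P) y + qform Rw (u - lqr_gain P *m y).
Proof.
move=> PT; set K := lqr_gain P.
have RT := pR.1.
have RK : Rw *m K = - (B^T *m P).
  by rewrite /K /lqr_gain mulmxN -mulmxA mulKVmx// posdef_unit.
have KRK : K^T *m Rw *m K = P *m S *m P.
  have -> : K^T = - (P *m B *m invmx Rw).
    by rewrite [LHS]linearN /= !trmx_mul trmxK trmx_inv RT PT mulmxA.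
  by rewrite -mulmxA RK mulNmx mulmxN opprK /S !mulmxA.
have -> : bform P (A *m y + B *m u) y = bform P y (A *m y + B *m u).
  by rewrite -{1}PT bform_tr.
rewrite -scaleN1r !qformE !(bformDl, bformDr, bformZl, bformZr).
have -> : bform Rw (K *m y) (K *m y) = bform (P *m S *m P) y y.
  by rewrite bform_mulr bform_mull mulmxA KRK.
have uK : bform Rw u (K *m y) = - bform P y (B *m u).
  by rewrite bform_mulr RK bform_mxN -[in RHS]PT bform_tr bform_mull.
have -> : bform Rw (K *m y) u = bform Rw u (K *m y).
  by rewrite -{1}RT bform_tr.
rewrite uK /riccati_map !bform_mxD bform_mxN.
have -> : bform (P *m A) y y = bform P y (A *m y) by rewrite bform_mulr.
have -> : bform (A^T *m P) y y = bform P y (A *m y).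
  by rewrite -bform_mull -{1}PT bform_tr.
ring.
Qed.

Lemma rate_ge0 (y : R -> 'cV[R]_n) (u : R -> 'cV[R]_m) t : 0 <= rate y u t.
Proof. by rewrite addr_ge0// qformE; exact: (posdef_psd _).2. Qed.

Variables (y0 : 'cV[R]_n) (u : R -> 'cV[R]_m) (y : R -> 'cV[R]_n).
Hypothesis lu : locally_square_integrable u.
Hypothesis sol : solution A B y0 u y.

Let py : primitive y0 (fun t => A *m y t + B *m u t) y.
Proof. exact: solution_primitive. Qed.

Let ly : locally_square_integrable y.
Proof. exact: primitive_lsi py. Qed.

Lemma rate_measurable : measurable_fun (`[0, +oo[%classic : set R) (rate y u).
Proof. by apply: measurable_funD; exact: lsi_bform_measurable. Qed.

Lemma rate_integrable T : mu.-integrable `[0, T] (EFin \o rate y u).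
Proof. by apply: integrableD_EFin; exact: lsi_bform_integrable. Qed.

(** The integral of [completed_square] over [0, T]. *)
Lemma lqr_balance P T : P^T = P -> 0 <= T ->
  let excess t :=
    qform (riccati_map A S Q P) (y t) + qform Rw (u t - lqr_gain P *m y t) in
  mu.-integrable `[0, T] (EFin \o excess) /\
  qform P (y T) + \int[mu]_(t in `[0, T]) rate y u t
  = qform P y0 + \int[mu]_(t in `[0, T]) excess t.
Proof.
move=> PT T0 excess; have [iq qT] := primitive_qform P py T0.
have iE : mu.-integrable `[0, T] (EFin \o excess).
  have := integrableD_EFin iq (rate_integrable T).
  by apply: eq_integrable => // t _ /=; rewrite completed_square.
split=> //; rewrite qT -addrA -RintegralD//; last exact: rate_integrable.
congr (_ + _); apply: eq_Rintegral => t _.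
by rewrite completed_square.
Qed.

Lemma subsolution_le_cost_to_go P T :
  P^T = P -> psd (riccati_map A S Q P) -> 0 <= T ->
  qform P y0 <= qform P (y T) + \int[mu]_(t in `[0, T]) rate y u t.
Proof.
move=> PT pric T0; have [iE ->] := lqr_balance PT T0.
rewrite lerDl; apply: Rintegral_ge0 => t _.
by rewrite addr_ge0// qformE ?pric.2 ?(posdef_psd pR).2.
Qed.

(** A cost v < y0^T P y0 keeps y^T P y above d = y0^T P y0 - v at all times by
    [subsolution_le_cost_to_go].  Since Q > 0 dominates a multiple of P, the
    running cost is then at least some k > 0, and exceeds v over a time
    (v + 1) / k. *)
Lemma lqr_cost_ge P : psd P -> psd (riccati_map A S Q P) ->
  ((qform P y0)%:E <= \int[mu]_(t in `[0%R, +oo[) (rate y u t)%:E)%E.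
Proof.
move=> pP pric; rewrite leNgt; apply/negP => lt_cost.
set V := (\int[mu]_(t in _) _)%E in lt_cost.
have V0 : (0 <= V)%E by apply: integral_ge0 => t _; rewrite lee_fin rate_ge0.
have Vfin : V \is a fin_num by rewrite ge0_fin_numE// (lt_trans lt_cost)// ltry.
pose v := fine V.
have v0 : 0 <= v by exact: fine_ge0.
have vP : v < qform P y0 by rewrite -lte_fin /v fineK.
have intv T : \int[mu]_(t in `[0, T]) rate y u t <= v.
  rewrite -lee_fin [v%:E](fineK Vfin).
  apply: (@improper_integral_ge R (rate y u)).
  - exact: rate_ge0.
  - exact: rate_measurable.
  - exact: rate_integrable.
pose d := qform P y0 - v.
have d0 : 0 < d by rewrite subr_gt0.
have Pd t : 0 <= t -> d <= qform P (y t).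
  move=> t0; have := subsolution_le_cost_to_go pP.1 pric t0; have := intv t.
  rewrite /d; lra.
have [c1 c10 h1] := bform_le_bform1 P.
have [c2 c20 h2] := posdef_coercive pQ.
pose k := d / (c1 * c2).
have k0 : 0 < k by rewrite divr_gt0// mulr_gt0.
have kr t : 0 <= t -> k <= rate y u t.
  move=> t0; apply: (@le_trans _ _ (qform Q (y t))); last first.
    by rewrite lerDl qformE (posdef_psd pR).2.
  rewrite ler_pdivrMr ?mulr_gt0// mulrC -mulrA (le_trans (Pd t t0))// qformE.
  rewrite (le_trans (ler_norm _))// (le_trans (h1 _))// ler_pM2l// qformE.
pose T := (v + 1) / k.
have Tgt0 : 0 < T by rewrite divr_gt0// ltr_wpDl.
have : \int[mu]_(t in `[0, T]) k <= v.
  apply: le_trans (intv T); apply: le_Rintegral => //.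
  - apply: continuous_compact_integrable; first exact: segment_compact.
    by move=> t; exact: cst_continuous.
  - exact: rate_integrable.
  - by move=> t /=; rewrite in_itv /= => /andP[t0 _]; exact: kr.
rewrite Rintegral_cst//= lebesgue_measure_itv/= lte_fin Tgt0 -EFinB /= subr0.
by rewrite mulrC divfK ?gt_eqF// gerDl ler10.
Qed.

(** Both excess terms of [lqr_balance] vanish, and y(T)^T P y(T) >= 0. *)
Lemma lqr_cost_le P : psd P -> riccati_map A S Q P = 0 ->
  u = (fun t => lqr_gain P *m y t) ->
  (\int[mu]_(t in `[0%R, +oo[) (rate y u t)%:E <= (qform P y0)%:E)%E.
Proof.
move=> pP ric0 uK; apply: (@improper_integral_le R (rate y u)).
- exact: rate_ge0.
- exact: rate_integrable.
move=> T T0; have [_] := lqr_balance pP.1 T0.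
have -> : \int[mu]_(t in `[0, T])
    (qform (riccati_map A S Q P) (y t)
     + qform Rw (u t - lqr_gain P *m y t)) = 0.
  transitivity (\int[mu]_(t in `[0, T]) (0 : R)).
    apply: eq_Rintegral => t _.
    by rewrite ric0 uK subrr !qformE bform0 /bform mulmx0 mxE addr0.
  by rewrite Rintegral_cst// mul0r.
by rewrite addr0 => <-; rewrite lerDr qformE pP.2.
Qed.

End LinearQuadraticRegulator.

(** * Optimal centroid stabilization *)

Section Centroid.
Variables (R : realType) (N n p : nat).
Notation mu := (@lebesgue_measure R).
Variables (A : 'M[R]_n) (B : 'M[R]_(n, p)) (Q : 'M[R]_n) (Rw : 'M[R]_(N * p)).
Hypothesis pQ : posdef Q.
Hypothesis pR : posdef Rw.

Let C : 'M[R]_(n, N * n) := sum_blocks N 1%:M.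
Let Bt : 'M[R]_(n, N * p) := sum_blocks N B.
Let S := Bt *m invmx Rw *m Bt^T.

Lemma output_solution x0 u x : stacked_solution A B x0 u x ->
  solution A Bt (output x0) u (fun t => output (x t)).
Proof.
move=> sol.
have -> : (fun t => output (x t)) = (fun t => C *m x t).
  by apply/funext => t; rewrite output_mulmx.
rewrite output_mulmx; have := primitive_mulmx C (solution_primitive sol).
have -> : (fun s => C *m (kron (1%:M : 'M[R]_N) A *m x s
    + kron (1%:M : 'M[R]_N) B *m u s)) = fun s => A *m (C *m x s) + Bt *m u s.
  apply/funext => s; rewrite mulmxDr !mulmxA !sum_blocks_kron !mul1mx.
  by rewrite /C mulmx_sum_blocks mulmx1.
exact: primitive_solution.
Qed.

Lemma riccati_optimal_feedback P : psd P -> riccati_map A S Q P = 0 ->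
  optimal_feedback A B Q Rw (lqr_gain Bt Rw P).
Proof.
move=> pP ric0 x0 K; set K' := lqr_gain Bt Rw P in K *.
split.
  pose M := kron (1%:M : 'M[R]_N) A + kron (1%:M : 'M[R]_N) B *m K' *m C.
  have [x] := linear_flow_exists M x0.
  have -> : (fun s => M *m x s) = fun s => kron (1%:M : 'M[R]_N) A *m x s
    + kron (1%:M : 'M[R]_N) B *m (K' *m output (x s)).
    by apply/funext => s; rewrite output_mulmx mulmxDl !mulmxA.
  by move=> px; exists x; exact: primitive_solution.
move=> x sol; have lu : locally_square_integrable (fun t => K' *m output (x t)).
  have -> : (fun t => K' *m output (x t)) = fun t => (K' *m C) *m x t.
    by apply/funext => t; rewrite output_mulmx mulmxA.
  exact/lsi_mulmx/(primitive_lsi (solution_primitive sol)).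
split=> // u' x' lu' sol'.
have up := lqr_cost_le pQ pR lu (output_solution sol) pP ric0 erefl.
have low : psd (riccati_map A S Q P) by rewrite ric0; exact: psd0.
exact: le_trans up (lqr_cost_ge pQ pR lu' (output_solution sol') pP low).
Qed.

(** The feedback attached to P attains y0^T P y0, which y0^T P' y0 bounds from
    below; exchange P and P', then polarize. *)
Lemma riccati_solution_unique P P' : psd P -> riccati_map A S Q P = 0 ->
  psd P' -> riccati_map A S Q P' = 0 -> P = P'.
Proof.
move=> pP ricP pP' ricP'.
have low P1 : riccati_map A S Q P1 = 0 -> psd (riccati_map A S Q P1).
  by move=> ->; exact: psd0.
have le_val P1 P2 y0 : psd P1 -> riccati_map A S Q P1 = 0 -> psd P2 ->
    riccati_map A S Q P2 = 0 -> bform P2 y0 y0 <= bform P1 y0 y0.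
  move=> p1 r1 p2 r2.
  have [y py] := linear_flow_exists (A + Bt *m lqr_gain Bt Rw P1) y0.
  have sol : solution A Bt y0 (fun t => lqr_gain Bt Rw P1 *m y t) y.
    apply: primitive_solution; move: py; congr (primitive _ _ _).
    by apply/funext => t; rewrite mulmxDl mulmxA.
  have lu : locally_square_integrable (fun t => lqr_gain Bt Rw P1 *m y t).
    exact/lsi_mulmx/(primitive_lsi py).
  have up := lqr_cost_le pQ pR lu sol p1 r1 erefl.
  rewrite -lee_fin.
  exact: le_trans (lqr_cost_ge pQ pR lu sol p2 (low _ r2)) up.
have eqv y0 : bform (P - P') y0 y0 = 0.
  by apply/eqP; rewrite bform_mxB subr_eq0 eq_le !le_val.
apply/eqP; rewrite -subr_eq0; apply/eqP/matrixP => i j; rewrite [RHS]mxE.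
have := eqv (delta_mx i 0 + delta_mx j 0).
rewrite !(bformDl, bformDr) !eqv !bform_delta add0r addr0.
have -> : (P - P') j i = (P - P') i j.
  by rewrite -[in LHS]pP.1 -[in LHS]pP'.1 !mxE.
lra.
Qed.

(** A diagonal entry of P is the value at a basis vector e_i, bounded by the
    cost of a control of the reduced system that steers e_i to the origin: each
    system receives 1 / N of a control steering (A, B) from e_i to 0. *)
Lemma subsolution_trace_bounded : (0 < N)%N -> controllable A B ->
  exists c, forall P, psd P -> psd (riccati_map A S Q P) -> \tr P <= c.
Proof.
move=> N0 ctrl.
have bound (i : 'I_n) : exists c, forall P,
    psd P -> psd (riccati_map A S Q P) -> P i i <= c.
  have [T [u [x [T0 lu sol xT]]]] := ctrl (delta_mx i 0) 0.
  pose J : 'M[R]_(N * p, p) := N%:R^-1 *: ones_kron N 1%:M.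
  have BJ : Bt *m J = B.
    rewrite /J -scalemxAr sum_blocks_ones_kron scalerA mulVf ?scale1r ?mulmx1//.
    by rewrite pnatr_eq0 -lt0n.
  have lv := lsi_mulmx lu J.
  have solv : solution A Bt (delta_mx i 0) (fun t => J *m u t) x.
    apply: primitive_solution; move: (solution_primitive sol).
    by congr (primitive _ _ _); apply/funext => t; rewrite mulmxA BJ.
  exists (\int[mu]_(t in `[0, T]) (qform Q (x t) + qform Rw (J *m u t))).
  move=> P pP rP; have := subsolution_le_cost_to_go pR lv solv pP.1 rP (ltW T0).
  by rewrite xT !qformE bform_delta /bform mulmx0 mxE add0r.
have [c hc] := choice bound.
by exists (\sum_i c i) => P pP rP; apply: ler_sum => i _; exact: hc.
Qed.

(** If P v = 0, all terms of v^T ric(P) v but v^T Q v vanish, so v = 0. *)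
Lemma riccati_posdef_solution_exists : (0 < N)%N -> controllable A B ->
  exists2 P, posdef P & riccati_map A S Q P = 0.
Proof.
move=> N0 ctrl; have [c trc] := subsolution_trace_bounded N0 ctrl.
have [P pP ricP] := riccati_solution_of_bounded_subsolutions
  (lqr_weight_sym Bt pR) (posdef_psd pQ) trc.
exists P => //; apply: psd_unit_posdef => // v Pv; apply/eqP/negP => /negP v0.
have := pQ.2 v v0; rewrite qformE.
suff -> : bform Q v v = bform (riccati_map A S Q P) v v.
  by rewrite ricP bform0 ltxx.
have M0 (M : 'M[R]_n) : bform (M *m P) v v = 0.
  by rewrite -bform_mulr Pv /bform mulmx0 mxE.
rewrite /riccati_map !bform_mxD bform_mxN !M0 -[bform (P *m A) v v]bform_tr.
by rewrite trmx_mul pP.1 M0 subr0 !add0r.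
Qed.

End Centroid.

Theorem mainTheorem4 (R : realType) (N n p : nat)
    (A : 'M[R]_n) (B : 'M[R]_(n, p)) (Q : 'M[R]_n) (Rw : 'M[R]_(N * p)) :
  (0 < N)%N -> controllable A B -> posdef Q -> posdef Rw ->
  (exists K : 'M[R]_(N * p, n), optimal_feedback A B Q Rw K) /\
  (forall W : 'M[R]_p, posdef W -> Rw = kron (1%:M : 'M[R]_N) W ->
    exists P : 'M[R]_n,
      let K := - ones_kron N (invmx W *m B^T *m P) in
      [/\ posdef P /\ riccati N A B Q W P,
          forall P' : 'M[R]_n, posdef P' -> riccati N A B Q W P' -> P' = P,
          optimal_feedback A B Q Rw K
        & forall (y : 'cV[R]_n) (i : 'I_N),
            block i (K *m y) = - (invmx W *m B^T *m P *m y)]).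
Proof.
move=> N0 ctrl pQ pR.
have [P pP ricP] := riccati_posdef_solution_exists pQ pR N0 ctrl.
have optP := riccati_optimal_feedback pQ pR (posdef_psd pP) ricP.
split; first by exists (lqr_gain (sum_blocks N B) Rw P).
move=> W pW RW.
have RinvB : invmx Rw *m (sum_blocks N B)^T = ones_kron N (invmx W *m B^T).
  rewrite sum_blocks_tr -[B^T in LHS](mulKVmx (posdef_unit pW)).
  by rewrite -kron_ones_kron -RW mulKmx ?posdef_unit.
have ricE P' : riccati N A B Q W P' <-> riccati_map A
    (sum_blocks N B *m invmx Rw *m (sum_blocks N B)^T) Q P' = 0.
  rewrite /riccati /riccati_map -[_ *m invmx Rw *m _]mulmxA RinvB.
  rewrite sum_blocks_ones_kron.
  by rewrite -scalemxAr -scalemxAl !mulmxA.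
have gainE : lqr_gain (sum_blocks N B) Rw P
    = - ones_kron N (invmx W *m B^T *m P).
  by rewrite /lqr_gain RinvB ones_kron_mulmx.
exists P; split.
- by split => //; exact/ricE.
- move=> P' pP' /ricE ricP'.
  exact: (riccati_solution_unique pQ pR (posdef_psd pP') ricP'
    (posdef_psd pP) ricP).
- by rewrite -gainE.
- move=> y i; apply/colP => k.
  by rewrite mulNmx -(block_ones_kron (invmx W *m B^T *m P) y i) !mxE.
Qed.
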